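(* There is an absolute constant $C>0$ with the following property. Let the smooth component $f$ of the problem $F^\star=\min_{x\in Q}\{F(x)=f(x)+\psi(x)\}$ be Quasi-Self-Concordant with parameter $M>0$. Let $x_0\in Q$ with $F(x_0)>F^\star$, $F'(x_0)\in\partial F(x_0)$, $g_0=\|F'(x_0)\|_*$, and let $\{x_k\}$, $\{g_k\}$ be generated by the Newton Method with Gradient Regularization described in the context, where in each iteration $i\ge0$ performed one has $g_i>0$ and $\sigma_i\in(0,2M]$ is chosen such that $$\langle F'(x_{i+1}),x_i-x_{i+1}\rangle\ \ge\ \frac{g_{i+1}^2}{2\sigma_i g_i}.$$ Assume that $D=\sup\{\|x-y\|: x,y\in Q,\ F(x)\le F(x_0),\ F(y)\le F(x_0)\}<+\infty$. Let $0<\varepsilon<1$. Then the relative accuracy guarantee $F(x_k)-F^\star\le\varepsilon\,(F(x_0)-F^\star)$ holds for every integer $k\ge1$ with $$k\ \ge\ C\Bigl(MD\ln\frac1\varepsilon+\ln\frac{Dg_0}{\varepsilon(F(x_0)-F^\star)}\Bigr),$$ i.e. the number of iterations to reach $\varepsilon$-accuracy is $O\bigl(MD\ln\frac1\varepsilon+\ln\frac{Dg_0}{\varepsilon(F(x_0)-F^\star)}\bigr)$.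
   Context: $\mathbb{E}$ is a finite-dimensional real vector space with dual $\mathbb{E}^*$; $\langle s,x\rangle$ denotes the value of $s\in\mathbb{E}^*$ at $x\in\mathbb{E}$. A self-adjoint positive-definite operator $B:\mathbb{E}\to\mathbb{E}^*$ is fixed, with norms $\|h\|=\langle Bh,h\rangle^{1/2}$ on $\mathbb{E}$ and $\|s\|_*=\langle s,B^{-1}s\rangle^{1/2}$ on $\mathbb{E}^*$. For $x\in Q$ write $\|h\|_x=\langle\nabla^2f(x)h,h\rangle^{1/2}$. Problem: $F^\star=\min_{x\in Q}\{F(x)=f(x)+\psi(x)\}$, where $\psi:\mathbb{E}\to\mathbb{R}\cup\{+\infty\}$ is a closed convex proper function, $Q=\operatorname{dom}\psi$, and $f:Q\to\mathbb{R}$ is convex and several times (at least three times) differentiable, with $\nabla f(x)\in\mathbb{E}^*$, $\nabla^2f(x)\succeq0$ and $D^3f(x)$ (a symmetric trilinear form) defined at every $x\in Q$. A minimizer $x^\star$ exists. $f$ is Quasi-Self-Concordant with parameter $M$ if $D^3f(x)[u,u,v]\le M\|u\|_x^2\|v\|$ for all $x\in Q$ and $u,v\in\mathbb{E}$. $\partial F(x)$ is the convex subdifferential of $F$. Newton Method with Gradient Regularization: given $x_0\in Q$, $F'(x_0)\in\partial F(x_0)$ and $g_0=\|F'(x_0)\|_*$, for $k\ge0$ choose $\sigma_k$ and set $$x_{k+1}=\arg\min_{y\in Q}\Bigl\{\langle\nabla f(x_k),y-x_k\rangle+\tfrac12\|y-x_k\|_{x_k}^2+\tfrac{\sigma_kg_k}{2}\|y-x_k\|^2+\psi(y)\Bigr\},$$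 $$F'(x_{k+1})=\nabla f(x_{k+1})-\nabla f(x_k)-\nabla^2f(x_k)(x_{k+1}-x_k)-\sigma_kg_kB(x_{k+1}-x_k)\in\partial F(x_{k+1}),\qquad g_{k+1}=\|F'(x_{k+1})\|_*.$$ *)

(* Defs.v *)
From HB Require Import structures.
From mathcomp Require Import all_boot all_order all_algebra.
From mathcomp Require Import all_classical all_reals all_analysis.

Set Implicit Arguments.
Unset Strict Implicit.
Unset Printing Implicit Defensive.
Import Order.TTheory GRing.Theory Num.Theory.
Local Open Scope classical_set_scope.
Local Open Scope ring_scope.

(* For s in the dual of E, the value <s, x> is the application s x. Multilinear
   forms are curried: an operator from E to its dual and the bilinear form that
   it represents are the same object. *)
Notation dual_of R E := 'Hom(E, R^o).
Notation bilin_of R E := 'Hom(E, 'Hom(E, R^o)).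
Notation trilin_of R E := 'Hom(E, 'Hom(E, 'Hom(E, R^o))).

Section Norms.
Variables (R : realType) (E : vectType R).

Definition selfadjoint (A : bilin_of R E) : Prop := forall x y, A x y = A y x.

Definition posdef (A : bilin_of R E) : Prop := forall x, x != 0 -> 0 < A x x.

Definition possemidef (A : bilin_of R E) : Prop := forall x, 0 <= A x x.

(* The norm of h for the scalar product A: this is ||h|| when A = B, and
   ||h||_x when A is the Hessian of f at x. *)
Definition formnorm (A : bilin_of R E) (h : E) : R := Num.sqrt (A h h).

Definition dualnorm (B : bilin_of R E) (s : dual_of R E) : R :=
  Num.sqrt (s ((B^-1)%VF s)).

End Norms.

Section ExtendedFunctions.
Variables (R : realType) (E : vectType R).
Implicit Types (phi : E -> \bar R) (Q : set E).

Definition edom phi : set E := [set x | (phi x < +oo)%E].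

Definition proper_ext phi : Prop :=
  (forall x, (-oo < phi x)%E) /\ (exists x, edom phi x).

Definition convex_ext phi : Prop := forall (x y : E) (t : R), 0 <= t <= 1 ->
  (phi (t *: x + (1 - t) *: y)%R <= t%:E * phi x + (1 - t)%R%:E * phi y)%E.

(* Closedness of the epigraph. A vectType carries no topology, so the one of E
   is given by the norm of B, as for the derivatives below. *)
Definition closed_ext (B : bilin_of R E) phi : Prop :=
  forall (x : E) (a : R),
    (forall e : R, 0 < e -> exists (y : E) (b : R),
        [/\ (phi y <= b%:E)%E, formnorm B (y - x) < e & `|b - a| < e]) ->
    (phi x <= a%:E)%E.

Definition subdiff phi (x : E) : set (dual_of R E) :=
  [set s | edom phi x /\ forall y, (phi x + (s (y - x)%R)%:E <= phi y)%E].

Definition argmin_on Q phi : set E :=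
  [set x | Q x /\ forall y, Q y -> (phi x <= phi y)%E].

Definition objective (f : E -> R) phi : E -> \bar R :=
  fun x => ((f x)%:E + phi x)%E.

Definition optval Q phi : \bar R := ereal_inf (phi @` Q).

Definition sublevel_diam (B : bilin_of R E) Q phi (c : \bar R) : \bar R :=
  ereal_sup [set d | exists x y, [/\ Q x, Q y, (phi x <= c)%E, (phi y <= c)%E
                                   & d = (formnorm B (x - y))%:E]].

End ExtendedFunctions.

Section Derivatives.
Variables (R : realType) (E : vectType R).

Definition convex_on (Q : set E) (f : E -> R) : Prop :=
  forall (x y : E) (t : R), Q x -> Q y -> 0 <= t <= 1 ->
    f (t *: x + (1 - t) *: y) <= t * f x + (1 - t) * f y.

(* Since f is a function on Q, which need not be open, its derivatives are
   Frechet derivatives relative to Q: only increments within Q are considered.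
   Spaces of multilinear forms carry the operator norm. For an f that is
   differentiable on a neighbourhood of Q, these are the usual derivatives; they
   are unique at every point of Q as soon as Q has an interior point. *)
Definition is_gradient (B : bilin_of R E) (Q : set E)
    (f : E -> R) (df : E -> dual_of R E) : Prop :=
  forall x, Q x -> forall e : R, 0 < e -> exists2 d : R, 0 < d &
    forall y, Q y -> formnorm B (y - x) < d ->
      `|f y - f x - df x (y - x)| <= e * formnorm B (y - x).

Definition is_hessian (B : bilin_of R E) (Q : set E)
    (df : E -> dual_of R E) (d2f : E -> bilin_of R E) : Prop :=
  forall x, Q x -> forall e : R, 0 < e -> exists2 d : R, 0 < d &
    forall y, Q y -> formnorm B (y - x) < d -> forall u : E,
      `|(df y - df x - d2f x (y - x)) u|
        <= e * formnorm B (y - x) * formnorm B u.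

Definition is_third_derivative (B : bilin_of R E) (Q : set E)
    (d2f : E -> bilin_of R E) (d3f : E -> trilin_of R E) : Prop :=
  forall x, Q x -> forall e : R, 0 < e -> exists2 d : R, 0 < d &
    forall y, Q y -> formnorm B (y - x) < d -> forall u v : E,
      `|(d2f y - d2f x - d3f x (y - x)) u v|
        <= e * formnorm B (y - x) * formnorm B u * formnorm B v.

Definition symmetric_trilin (T : trilin_of R E) : Prop :=
  forall u v w, T u v w = T v u w /\ T u v w = T u w v.

Definition smooth_convex_on (B : bilin_of R E) (Q : set E) (f : E -> R)
    (df : E -> dual_of R E) (d2f : E -> bilin_of R E)
    (d3f : E -> trilin_of R E) : Prop :=
  [/\ convex_on Q f,
      is_gradient B Q f df,
      is_hessian B Q df d2f,
      is_third_derivative B Q d2f d3f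
    & forall x, Q x ->
        [/\ selfadjoint (d2f x), possemidef (d2f x) & symmetric_trilin (d3f x)]].

Definition quasi_self_concordant (B : bilin_of R E) (Q : set E)
    (d2f : E -> bilin_of R E) (d3f : E -> trilin_of R E) (M : R) : Prop :=
  forall x, Q x -> forall u v : E,
    d3f x u u v <= M * formnorm (d2f x) u ^+ 2 * formnorm B v.

End Derivatives.

Section Method.
Variables (R : realType) (E : vectType R).
Variables (B : bilin_of R E) (f : E -> R) (df : E -> dual_of R E).
Variables (d2f : E -> bilin_of R E) (psi : E -> \bar R).

Definition newton_model (sigma g : R) (x y : E) : \bar R :=
  ((df x (y - x) + 2^-1 * formnorm (d2f x) (y - x) ^+ 2
    + sigma * g / 2 * formnorm B (y - x) ^+ 2)%:E + psi y)%E.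

(* One iteration, from the point x with subgradient s to the point x' with
   subgradient s'. *)
Definition newton_step (sigma : R) (x : E) (s : dual_of R E)
    (x' : E) (s' : dual_of R E) : Prop :=
  let g := dualnorm B s in
  [/\ argmin_on (edom psi) (newton_model sigma g x) x',
      s' = df x' - df x - d2f x (x' - x) - (sigma * g) *: B (x' - x)
    & subdiff (objective f psi) x' s'].

End Method.

(* Main.v *)
Require Import Defs.
From HB Require Import structures.
From mathcomp Require Import all_boot all_order all_algebra.
From mathcomp Require Import all_classical all_reals all_analysis.
From mathcomp Require Import ring lra.

Set Implicit Arguments.
Unset Strict Implicit.
Unset Printing Implicit Defensive.
Import Order.TTheory GRing.Theory Num.Theory.
Local Open Scope classical_set_scope.
Local Open Scope ring_scope.

(** Write d_i = F(x_i) - F^* and g_i = ||F'(x_i)||_*. Two inequalities drive the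
    rate:
    - convexity gives d_i <= <F'(x_i), x_i - x^*> <= D g_i ([subdiff_gap_le] and
      [dual_pairing_le]), because the method is monotone and so every x_i stays
      in the sublevel set of diameter D;
    - convexity and the choice of sigma_i <= 2M give
      d_i - d_{i+1} >= <F'(x_{i+1}), x_i - x_{i+1}> >= g_{i+1}^2 / (4 M g_i).
    Dividing the second one by d_i and using the first one on the right,
    ln d_i - ln d_{i+1} >= (g_{i+1} / g_i)^2 / (4 M D): the logarithm of the gap
    drops by a fixed amount unless the gradient norm shrinks by a fixed factor.
    The gradient norm cannot shrink at many steps, as g_i >= d_i / D.

    This alternative is made quantitative by t^2 >= 1 + 2 ln t at
    t = g_{i+1} / g_i. It makes 4 M D ln d_i + 2 ln g_i a potential that
    decreases by at least 1 per iteration, whence ([iteration_count_le])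
      k <= 4 M D ln (d_0 / d_k) + 2 ln (g_0 / g_k).
    If d_k > eps d_0, then g_k > eps d_0 / D too, and both logarithms are smaller
    than those of the claimed complexity; so C = 4 contradicts the choice
    of k. *)

(** In general B^-1 is only a right inverse of B on the image of B. A definite B
    is injective, hence onto, since E and its dual have the same dimension. *)
Lemma posdef_lfunVK (R : realType) (E : vectType R) (B : bilin_of R E) :
  posdef B -> cancel (B^-1)%VF B.
Proof.
move=> Bpos s; apply: limg_lfunVK.
have ker0 : (lker B == 0)%VS.
  rewrite -subv0; apply/subvP=> v; rewrite memv_ker memv0 => /eqP Bv0.
  by apply/negPn/negP=> /Bpos; rewrite Bv0 lfunE /= ltxx.
suff -> : limg B = fullv by exact: memvf.
apply/eqP; rewrite eqEdim subvf /= limg_dim_eq; last by rewrite (eqP ker0) capv0.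
by rewrite !dimvf /dim /= muln1.
Qed.

Lemma posdef_cauchy_schwarz (R : realType) (E : vectType R)
    (A : bilin_of R E) (x y : E) :
  selfadjoint A -> posdef A -> A x y <= formnorm A x * formnorm A y.
Proof.
move=> Asym Apos.
have Age0 z : 0 <= A z z.
  have [->|/Apos/ltW//] := eqVneq z 0; by rewrite linear0.
have [->|y0] := eqVneq y 0; first by rewrite linear0 mulr_ge0 ?sqrtr_ge0.
rewrite /formnorm -sqrtrM// (le_trans (ler_norm _))// -sqrtr_sqr.
apply: ler_wsqrtr.
have Ay := Apos _ y0.
(* Up to the factor A y y, this vector is the component of x orthogonal to y. *)
have := Age0 (A y y *: x - A x y *: y).
have -> : A (A y y *: x - A x y *: y) (A y y *: x - A x y *: y)
          = A y y * (A x x * A y y - A x y ^+ 2).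
  have expr_r u : A u (A y y *: x - A x y *: y)
                  = A y y * A u x - A x y * A u y.
    by rewrite raddfB /= !linearZ.
  have expr_l u : A (A y y *: x - A x y *: y) u
                  = A y y * A x u - A x y * A y u.
    by rewrite Asym expr_r !(Asym u).
  by rewrite expr_r !expr_l (Asym y x); ring.
by rewrite pmulr_rge0// subr_ge0.
Qed.

(** This is the Cauchy-Schwarz inequality for B at the vector B^-1 s. *)
Lemma dual_pairing_le (R : realType) (E : vectType R) (B : bilin_of R E)
    (s : dual_of R E) (h : E) :
  selfadjoint B -> posdef B -> s h <= dualnorm B s * formnorm B h.
Proof.
move=> Bsym Bpos; have BVs := posdef_lfunVK Bpos s.
rewrite -{1}BVs (le_trans (posdef_cauchy_schwarz _ _ Bsym Bpos))//.
by rewrite /dualnorm -{2}BVs.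
Qed.

(** The bound ln t <= t - 1 at t = b / a; it compares a relative decrease with a
    decrease of logarithms. *)
Lemma lnB_ge (R : realType) (a b : R) :
  0 < a -> 0 < b -> 1 - b / a <= ln a - ln b.
Proof.
move=> a0 b0; have r0 : 0 < b / a by rewrite divr_gt0.
have : ln (1 + (b / a - 1)) <= b / a - 1 by apply: le_ln1Dx; lra.
rewrite addrC subrK ln_div ?posrE//; lra.
Qed.

(** The function c D ln d_i + 2 ln g_i decreases by at least 1 at each step: if
    r = (g_{i+1} / g_i)^2, then 1 <= r - ln r, where r is at most
    c D (d_i - d_{i+1}) / d_i and therefore at most c D (ln d_i - ln d_{i+1}). *)
Lemma iteration_count_le (R : realType) (c D : R) (d g : nat -> R) (k : nat) :
  0 <= c ->
  (forall i, (i <= k)%N -> [/\ 0 < d i, 0 < g i & d i <= D * g i]) ->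
  (forall i, (i < k)%N -> g i.+1 ^+ 2 <= c * g i * (d i - d i.+1)) ->
  k%:R <= c * D * (ln (d 0%N) - ln (d k)) + 2 * (ln (g 0%N) - ln (g k)).
Proof.
move=> c0; elim: k => [|k IH] bnd dec; first by rewrite !subrr !mulr0 addr0.
have {IH} := IH (fun i le_ik => bnd i (leqW le_ik)) (fun i lt_ik => dec i (leqW lt_ik)).
have [dk gk dDgk] := bnd k (leqnSn k).
have [dk1 gk1 _] := bnd k.+1 (leqnn _).
have deck := dec k (leqnn _).
have g2 : 0 < g k ^+ 2 by rewrite exprn_gt0.
have g21 : 0 < g k.+1 ^+ 2 by rewrite exprn_gt0.
have lng : 1 - g k.+1 ^+ 2 / g k ^+ 2 <= 2 * (ln (g k) - ln (g k.+1)).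
  by have := lnB_ge g2 g21; rewrite !lnXn// -mulrnBl mulr_natl.
have lnd := lnB_ge dk dk1.
have drop : 0 <= c * (d k - d k.+1).
  by rewrite -(pmulr_rge0 _ gk) (le_trans (ltW g21))// mulrCA mulrA.
have D0 : 0 <= c * D.
  by rewrite mulr_ge0// -(pmulr_lge0 _ gk) (le_trans (ltW dk)).
have ratio : g k.+1 ^+ 2 / g k ^+ 2 <= c * D * (1 - d k.+1 / d k).
  rewrite ler_pdivrMr// (le_trans deck)//.
  have -> : c * D * (1 - d k.+1 / d k) * g k ^+ 2
          = c * (d k - d k.+1) * g k * ((D * g k) / d k).
    by field; rewrite gt_eqF.
  have -> : c * g k * (d k - d k.+1) = c * (d k - d k.+1) * g k by ring.
  (* The last factor is at least 1 by the bound d k <= D * g k. *)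
  by apply: ler_peMr; [rewrite mulr_ge0// ltW|rewrite ler_pdivlMr// mul1r].
have := ler_wpM2l D0 lnd; rewrite -natr1; lra.
Qed.

Lemma objective_fin_num (R : realType) (E : vectType R)
    (f : E -> R) (psi : E -> \bar R) (x : E) :
  proper_ext psi -> edom psi x -> objective f psi x \is a fin_num.
Proof.
by move=> [psi_gt _] Qx; rewrite fin_numD /= fin_numElt psi_gt.
Qed.

Lemma optval_argmin (R : realType) (E : vectType R)
    (Q : set E) (phi : E -> \bar R) (x : E) :
  argmin_on Q phi x -> optval Q phi = phi x.
Proof.
move=> [Qx xmin]; apply/eqP; rewrite eq_le; apply/andP; split.
  by apply: ereal_inf_lbound; exists x.
by apply: le_ereal_inf_tmp => _ [y Qy <-]; exact: xmin.
Qed.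

Lemma subdiff_gap_le (R : realType) (E : vectType R) (phi : E -> \bar R)
    (s : dual_of R E) (x y : E) :
  subdiff phi x s -> phi x \is a fin_num -> phi y \is a fin_num ->
  fine (phi x) - fine (phi y) <= s (x - y).
Proof.
move=> [_ /(_ y)] + phix phiy; rewrite -(fineK phix) -(fineK phiy) lee_fin /=.
rewrite -[x - y]opprB linearN /= => ?; lra.
Qed.

Theorem corollary3p4 (R : realType) :
  exists C : R, 0 < C /\
  forall (E : vectType R) (B : bilin_of R E)
    (psi : E -> \bar R) (f : E -> R)
    (df : E -> dual_of R E) (d2f : E -> bilin_of R E)
    (d3f : E -> trilin_of R E) (M : R),
  let Q := edom psi in
  let F := objective f psi in
  let Fstar := optval Q F in
  selfadjoint B -> posdef B ->
  proper_ext psi -> convex_ext psi -> closed_ext B psi ->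
  smooth_convex_on B Q f df d2f d3f ->
  (exists xstar : E, argmin_on Q F xstar) ->
  0 < M -> quasi_self_concordant B Q d2f d3f M ->
  forall (x : nat -> E) (F' : nat -> dual_of R E) (sigma : nat -> R)
    (D eps : R) (k : nat),
  let g := fun i => dualnorm B (F' i) in
  Q (x 0%N) -> (Fstar < F (x 0%N))%E -> subdiff F (x 0%N) (F' 0%N) ->
  (forall i : nat, (i < k)%N ->
     [/\ 0 < g i,
         0 < sigma i <= 2 * M,
         newton_step B f df d2f psi (sigma i) (x i) (F' i) (x i.+1) (F' i.+1)
       & F' i.+1 (x i - x i.+1) >= g i.+1 ^+ 2 / (2 * sigma i * g i)]) ->
  sublevel_diam B Q F (F (x 0%N)) = D%:E ->
  0 < eps < 1 ->
  (1 <= k)%N ->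
  k%:R >= C * (M * D * ln (1 / eps)
               + ln (D * g 0%N / (eps * fine (F (x 0%N) - Fstar)%E))) ->
  (F (x k) - Fstar <= eps%:E * (F (x 0%N) - Fstar))%E.
Proof.
exists 4; split=> // E B psi f df d2f d3f M Q F Fstar Bsym Bpos psi_proper
  _ _ _ [xs xs_min] M0 _ x F' sigma D eps k g Qx0 Fx0_gt sub0 steps diamD
  /andP[eps0 eps1] k_gt0.
have FstarE : Fstar = F xs by exact: optval_argmin xs_min.
rewrite FstarE.
have [Qxs xs_le] := xs_min.
have Qx i : (i <= k)%N -> Q (x i).
  by case: i => [//|i] /steps[_ _ [[]]].
have subx i : (i <= k)%N -> subdiff F (x i) (F' i).
  by case: i => [//|i] /steps[_ _ []].
have Ffin y : Q y -> F y \is a fin_num by exact: objective_fin_num.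
pose d i := fine (F (x i)) - fine (F xs).
have dE i : (i <= k)%N -> (F (x i) - F xs)%E = (d i)%:E.
  by move=> ik; rewrite EFinB !fineK//; apply: Ffin => //; exact: Qx.
have d_drop i : (i < k)%N -> g i.+1 ^+ 2 <= 4 * M * g i * (d i - d i.+1).
  move=> ik; have [gi /andP[s0 sM] _ sub_le] := steps _ ik.
  have := subdiff_gap_le (subx _ ik) (Ffin _ (Qx _ ik)) (Ffin _ (Qx _ (ltnW ik))).
  rewrite -[x i.+1 - x i]opprB linearN /= => gap.
  have dle : g i.+1 ^+ 2 / (2 * sigma i * g i) <= d i - d i.+1.
    by apply: le_trans sub_le _; rewrite /d; lra.
  have sg0 : 0 < 2 * sigma i * g i by rewrite !mulr_gt0.
  have d_ge0 : 0 <= d i - d i.+1.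
    by apply: le_trans dle; rewrite divr_ge0 ?sqr_ge0 ?ltW.
  move: dle; rewrite ler_pdivrMr// => /le_trans; apply.
  rewrite mulrC ler_wpM2r// ler_wpM2r ?(ltW gi)//; lra.
have d_le i j : (i <= j)%N -> (j <= k)%N -> d j <= d i.
  elim: j => [|j IH]; first by rewrite leqn0 => /eqP ->.
  rewrite leq_eqVlt => /orP[/eqP -> //|ij] jk.
  apply: le_trans (IH ij (ltnW jk)).
  have [gj _ _ _] := steps _ jk; rewrite -subr_ge0.
  have c0 : 0 < 4 * M * g j by rewrite !mulr_gt0.
  by rewrite -(pmulr_rge0 _ c0) (le_trans _ (d_drop _ jk))// sqr_ge0.
have d_gradient i : (i <= k)%N -> d i <= D * g i.
  move=> ik.
  apply: le_trans (subdiff_gap_le (subx _ ik) (Ffin _ (Qx _ ik)) (Ffin _ Qxs)) _.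
  apply: le_trans (dual_pairing_le _ _ Bsym Bpos) _.
  rewrite mulrC ler_wpM2r ?sqrtr_ge0// -lee_fin -diamD.
  apply: ereal_sup_ubound; exists (x i), xs; split=> //.
  - exact: Qx.
  - rewrite -(fineK (Ffin _ (Qx _ ik))) -(fineK (Ffin _ Qx0)) lee_fin.
    by have := d_le _ _ (leq0n i) ik; rewrite /d lerD2r.
  - exact: xs_le.
rewrite !dE// -EFinM lee_fin /= => k_ge.
rewrite leNgt; apply/negP=> far.
have d0 : 0 < d 0%N.
  by rewrite -lte_fin -dE// sube_gt0 ?Ffin// -FstarE.
have ed0 : 0 < eps * d 0%N by rewrite mulr_gt0.
have dk : 0 < d k by exact: lt_trans far.
have [g0 _ _ _] := steps _ k_gt0.
have D0 : 0 < D by rewrite -(pmulr_lgt0 _ g0) (lt_le_trans d0)// d_gradient.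
have dgt i : (i <= k)%N -> 0 < d i.
  by move=> ik; apply: lt_le_trans dk (d_le _ _ ik (leqnn k)).
have gpos i : (i <= k)%N -> 0 < g i.
  by move=> ik; rewrite -(pmulr_rgt0 _ D0) (lt_le_trans (dgt _ ik))// d_gradient.
have count : k%:R <= 4 * M * D * (ln (d 0%N) - ln (d k))
                     + 2 * (ln (g 0%N) - ln (g k)).
  apply: iteration_count_le => // [|i ik]; first by rewrite mulr_ge0// ltW.
  by split; [exact: dgt|exact: gpos|exact: d_gradient].
have lnd : ln (d 0%N) - ln (d k) < ln (1 / eps).
  have : ln (eps * d 0%N) < ln (d k) by rewrite ltr_ln ?posrE.
  by rewrite lnM ?posrE// div1r lnV ?posrE//; lra.
have lng : ln (g 0%N) - ln (g k) < ln (D * g 0%N / (eps * d 0%N)).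
  have : ln (eps * d 0%N) < ln (D * g k).
    by rewrite ltr_ln ?posrE ?mulr_gt0 ?gpos// (lt_le_trans far)// d_gradient.
  by rewrite ln_div ?posrE ?mulr_gt0// !(lnM (x := D)) ?posrE ?gpos//; lra.
have L0 : 0 <= ln (D * g 0%N / (eps * d 0%N)).
  rewrite ln_ge0// ler_pdivlMr// mul1r (le_trans _ (d_gradient _ (leq0n k)))//.
  by rewrite ler_piMl// ltW.
have MD0 : 0 < M * D by rewrite mulr_gt0.
have : M * D * (ln (d 0%N) - ln (d k)) < M * D * ln (1 / eps).
  by rewrite ltr_pM2l.
lra.
Qed.
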